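(* Let $k\ge 0$ be an integer and let $f(x)$ be any polynomial over $\mathbb{Z}/2$ of degree at most $2^k$. Then $$\lambda(f)\le 4\Big(1-\frac{1}{2^{k+2}}\Big)^{\frac{1}{k+1}}.$$
   Context: For a polynomial $f$ over $\mathbb{Z}/2$, let $q_f(i)$ be the number of nonzero coefficients of $f(x)^i$ modulo $2$ and $r_f(n)=\sum_{i=0}^{n-1}q_f(i)$. $\lambda(f)$ denotes the Perron–Frobenius (largest positive) eigenvalue of Willson's nonnegative integer transition matrix $B$ associated with $f$ and $p=2$ (S. Willson's matrix method, for which $u B^k v=r_f(2^k)$ for suitable vectors $u,v$); it governs the growth of the number of nonzero coefficients: $\log\lambda(f)=\lim_{k\to\infty}\frac{\log r_f(2^k)}{k}$, and $\log_2\lambda(f)$ is the fractal dimension of the associated fractal. *)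

(* Defs.v *)
From mathcomp Require Import all_boot all_order all_algebra.
From mathcomp Require Import all_classical all_reals.

Set Implicit Arguments.
Unset Strict Implicit.
Unset Printing Implicit Defensive.
Import Order.TTheory GRing.Theory Num.Theory.
Local Open Scope ring_scope.

(* Width of Willson's blocks: [deg f], replaced by 1 when [f] is constant so   *)
(* that nonzero blocks exist.                                                 *)
Definition width (f : {poly 'F_2}) : nat := maxn 1 (size f).-1.

(* A block is accessible when it is a string of [width f] consecutive         *)
(* coefficients of some power of [f]; the factor ['X^w] pads with zeros on    *)
(* the left, so that strings overlapping the low-degree end are included.     *)
Definition accessible (f : {poly 'F_2}) (b : 'rV['F_2]_(width f)) : Prop :=
  exists i m : nat,
    forall l : 'I_(width f), b 0 l = ('X^(width f) * f ^+ i)`_(m + l).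

Definition blocks (f : {poly 'F_2}) : {set 'rV['F_2]_(width f)} :=
  [set b | (b != 0) && `[< accessible b >]].

(* Let [w = width f].  If [s] is the block of [f ^+ i] starting at position m,*)
(* then, as [f ^+ (2 * i + e) = f ^+ e * (f ^+ i \Po 'X^2)], it determines    *)
(* the coefficients of [f ^+ (2 * i + e)] (e = 0, 1) at the [w.+1] positions  *)
(* 2m + w - 1, ..., 2m + 2w - 1: these are two blocks of width w, starting at *)
(* 2m + w - 1 + c for c = 0, 1.  As m and i vary, each block of each power of *)
(* [f] arises exactly once in this way.                                       *)
Definition child (f : {poly 'F_2}) (e c : 'I_2) (s : 'rV['F_2]_(width f)) :
    'rV['F_2]_(width f) :=
  \row_(l < width f)
    (f ^+ e * (rVpoly s \Po 'X^2))`_((width f).-1 + c + l).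

Definition transition_mx (f : {poly 'F_2}) : 'M[nat]_#|blocks f| :=
  \matrix_(s, t)
    #|[set ec : 'I_2 * 'I_2 | child ec.1 ec.2 (enum_val s) == enum_val t]|.

(* The set is finite, and by Perron-Frobenius it is nonempty as soon as [A]   *)
(* is not nilpotent; the supremum is then the largest positive eigenvalue.    *)
Definition perron_root (R : realType) (n : nat) (A : 'M[nat]_n) : R :=
  sup [set a : R | 0 < a /\ eigenvalue (map_mx (fun x : nat => x%:R : R) A) a].

Definition lambda (R : realType) (f : {poly 'F_2}) : R :=
  perron_root R (transition_mx f).

(* Main.v *)
Require Import Defs.
From mathcomp Require Import all_boot all_order all_algebra.
From mathcomp Require Import all_classical all_reals all_analysis.
From mathcomp Require Import zify.

Set Implicit Arguments.
Unset Strict Implicit.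
Unset Printing Implicit Defensive.
Import Order.TTheory GRing.Theory Num.Theory.
Local Open Scope ring_scope.

(* The 4 ^ n descendants of a block in generation n contain 2 ^ n that come   *)
(* from the path e = 0, i.e. windows of s(x ^ (2 ^ n)) with consecutive       *)
(* starting positions. Such a window has width w = width f and is zero unless *)
(* it meets a multiple of 2 ^ n, which happens at most w times. Hence the row *)
(* sums of the n-th power of the transition matrix are at most                *)
(* 4 ^ n - 2 ^ n + w; for n = k + 1 and w <= 2 ^ k this is at most            *)
(* 4 ^ n - 2 ^ k = 4 ^ n * (1 - 1 / 2 ^ (k + 2)).                             *)

(** Any positive eigenvalue [a] of the transition matrix has [a ^+ n] at most the largest row sum of
    the n-th power ([eigenvalue_transition_le]), and row sums are bounded by numbers of nonzero
    descendants. The savings come from the path e = 0 alone ([descendants_le0], [descendants0_le]);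
    with n = k + 1, a root of order k + 1 gives the bound. *)

Fixpoint descendants (f : {poly 'F_2}) (n : nat) (s : 'rV['F_2]_(width f)) : nat :=
  if n is n'.+1 then
    (\sum_(ec : 'I_2 * 'I_2) descendants n' (child ec.1 ec.2 s))%N
  else s != 0.

Fixpoint descendants0 (f : {poly 'F_2}) (n : nat) (s : 'rV['F_2]_(width f)) : nat :=
  if n is n'.+1 then (\sum_(c : 'I_2) descendants0 n' (child ord0 c s))%N
  else s != 0.

Lemma descendants_le (f : {poly 'F_2}) n (s : 'rV['F_2]_(width f)) :
  (descendants n s <= 4 ^ n)%N.
Proof.
elim: n s => [|n IHn] s /=; first by case: (_ != _).
apply: (@leq_trans (\sum_(ec : 'I_2 * 'I_2) 4 ^ n)%N).
  by apply: leq_sum => ec _; exact: IHn.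
by rewrite sum_nat_const card_prod card_ord expnS.
Qed.

(** The zero blocks on the path e = 0 are among all zero descendants; children with e = 1 get only
    the trivial bound. *)
Lemma descendants_le0 (f : {poly 'F_2}) n (s : 'rV['F_2]_(width f)) :
  (descendants n s + 2 ^ n <= 4 ^ n + descendants0 n s)%N.
Proof.
elim: n s => [|n IHn] s /=; first by rewrite addnC.
rewrite -(pair_bigA _ (fun e c => descendants n (child e c s))) /=.
rewrite !big_ord_recl !big_ord0 /= !addn0.
have := IHn (child ord0 ord0 s); have := IHn (child ord0 (lift ord0 ord0) s).
set e1 := lift _ _.
have := descendants_le n (child e1 ord0 s); have := descendants_le n (child e1 e1 s).
rewrite !expnS; lia.
Qed.

Lemma sum_dvdn_le1 N x : (\sum_(C < N) (N %| x + C) <= 1)%N.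
Proof.
case: N => [|N]; first by rewrite big_ord0.
have [/existsP[C0 dC0]|/existsPn nd] := boolP [exists C : 'I_N.+1, (N.+1 %| x + C)%N].
  rewrite (bigD1 C0) //= dC0 big1 // => C neC; apply/eqP; rewrite eqb0.
  apply: contra neC => dC; apply/eqP/val_inj => /=.
  have /eqP : (x + C = x + C0 %[mod N.+1])%N by rewrite (eqP dC) (eqP dC0).
  by rewrite eqn_modDl !modn_small ?ltn_ord // => /eqP.
by rewrite big1 // => C _; apply/eqP; rewrite eqb0.
Qed.

Lemma child0_neq0 (f : {poly 'F_2}) (c : 'I_2) (s : 'rV['F_2]_(width f)) l :
  child ord0 c s 0 l != 0 ->
  exists2 j : 'I_(width f), s 0 j != 0 & (2 * j = (width f).-1 + c + l)%N.
Proof.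
rewrite mxE expr0 mul1r coef_comp_poly_Xn //.
case: ifP => [dvd2|_]; last by rewrite eqxx.
rewrite coef_rVpoly; case: insubP => [j _ ej nz|_]; last by rewrite eqxx.
by exists j; rewrite // ej mulnC divnK.
Qed.

(* The induction starts at M = 1, a = 0; after m steps M = 2 ^ m and a is the  *)
(* starting position of s as a window of s0(x ^ (2 ^ m)), s0 the ancestor.    *)
Lemma descendants0_le_sum (f : {poly 'F_2}) n M a (s : 'rV['F_2]_(width f)) :
  (forall l, s 0 l != 0 -> (M %| a + l)%N) ->
  (descendants0 n s <= \sum_(l < width f) \sum_(C < 2 ^ n)
     (2 ^ n * M %| 2 ^ n * a + (2 ^ n).-1 * (width f).-1 + l + C))%N.
Proof.
elim: n M a s => [|n IHn] M a s hs /=.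
  have [_|/rV0Pn[l nz]] := eqVneq s 0; first by [].
  rewrite (bigD1 l) //= big_ord_recl /=.
  by rewrite expn0 !mul1n mul0n !addn0 hs.
(* One generation sends the start a to 2a + w - 1 + c. The first choice c is thus the leading binary
   digit of the index [C]. *)
have step (c : 'I_2) : (descendants0 n (child ord0 c s) <=
   \sum_(l < width f) \sum_(C < 2 ^ n) (2 ^ n.+1 * M %|
     2 ^ n.+1 * a + (2 ^ n.+1).-1 * (width f).-1 + l + (c * 2 ^ n + C)))%N.
  apply: leq_trans (IHn (2 * M)%N (2 * a + (width f).-1 + c)%N _ _) _.
    move=> l /child0_neq0[j /hs Mj ej].
    have -> : (2 * a + (width f).-1 + c + l = 2 * (a + j))%N by lia.
    by rewrite dvdn_pmul2l.
  apply/eq_leq/eq_bigr => l _; apply: eq_bigr => C _; congr nat_of_bool; congr dvdn.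
    by rewrite expnS mulnA (mulnC 2%N).
  have := expn_gt0 2 n; rewrite expnS; nia.
rewrite !big_ord_recl big_ord0 addn0.
apply: leq_trans (leq_add (step _) (step _)) _.
rewrite -big_split; apply: leq_sum => l _ /=.
have sum_split (F : nat -> nat) : (\sum_(C < 2 ^ n.+1) F C =
    \sum_(C < 2 ^ n) F C + \sum_(C < 2 ^ n) F (2 ^ n + C))%N.
  by rewrite expnS mul2n -addnn big_split_ord.
rewrite (sum_split (fun C => nat_of_bool (_ %| _ + C)%N)) /bump /= !mul1n.
by under eq_bigr do rewrite mul0n add0n.
Qed.

(** Count by offset: for fixed [l], the entries at [l] of the 2 ^ n windows occupy consecutive
    positions, at most one a multiple of 2 ^ n. *)
Lemma descendants0_le (f : {poly 'F_2}) n (s : 'rV['F_2]_(width f)) :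
  (descendants0 n s <= width f)%N.
Proof.
apply: leq_trans (@descendants0_le_sum f n 1 0 s _) _ => [l _|].
  exact: dvd1n.
apply: (@leq_trans (\sum_(l < width f) 1)%N).
  by apply: leq_sum => l _; rewrite muln1; exact: sum_dvdn_le1.
by rewrite sum_nat_const card_ord muln1.
Qed.

(** The left side counts through children lying in [blocks f]; any other child only adds to the
    right side. *)
Lemma transition_descendants_le (f : {poly 'F_2}) n (s : 'I_#|blocks f|) :
  (\sum_t transition_mx f s t * descendants n (enum_val t)
     <= descendants n.+1 (enum_val s))%N.
Proof.
under eq_bigr => t _.
  rewrite mxE -sum1_card big_mkcond /= big_distrl /=.
  under eq_bigr => ec _ do rewrite inE.
  over.
rewrite exchange_big /=; apply: leq_sum => ec _; set b := child _ _ _.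
rewrite -(big_enum_val (A := mem (blocks f))
  (fun x => (if b == x then 1 else 0) * descendants n x)%N) /=.
have [bB|nbB] := boolP (b \in blocks f).
  rewrite (bigD1 b) //= eqxx mul1n big1 ?addn0 // => x /andP[_].
  by rewrite eq_sym => /negbTE ->.
rewrite big1 // => x xB; case: eqP => // bx; by rewrite bx xB in nbB.
Qed.

Lemma eigenvalue_transition_le (R : realType) (f : {poly 'F_2}) (a : R) n m :
  0 < a ->
  eigenvalue (map_mx (fun x : nat => x%:R : R) (transition_mx f)) a ->
  (forall s : 'rV_(width f), descendants n s <= m)%N -> a ^+ n <= m%:R.
Proof.
move=> a0 /eigenvalueP[v va vn0] hm.
(* Weights are absolute values of a left eigenvector; by the triangle inequality [B] grows at least
   by the factor [a] per generation. *)
pose B j := \sum_s `|v 0 s| * (descendants j (enum_val s))%:R.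
have stepB j : a * B j <= B j.+1.
  rewrite /B mulr_sumr.
  apply: (@le_trans _ _ (\sum_s \sum_t
    `|v 0 s| * (transition_mx f s t * descendants j (enum_val t))%N%:R)).
    rewrite exchange_big /=; apply: ler_sum => t _.
    rewrite mulrA -{1}(gtr0_norm a0) -normrM.
    have -> : a * v 0 t = \sum_s v 0 s * (transition_mx f s t)%:R.
      have /rowP/(_ t) := va; rewrite !mxE => <-.
      by apply: eq_bigr => s _; rewrite !mxE.
    under [leRHS]eq_bigr do rewrite natrM mulrA.
    rewrite -mulr_suml ler_wpM2r //.
    apply: le_trans (ler_norm_sum _ _ _) _; apply: ler_sum => s _.
    by rewrite normrM normr_nat.
  apply: ler_sum => s _; rewrite -mulr_sumr ler_wpM2l // -natr_sum ler_nat.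
  exact: transition_descendants_le.
have powB j : a ^+ j * B 0%N <= B j.
  elim: j => [|j IHj]; first by rewrite mul1r.
  by rewrite exprS -mulrA (le_trans _ (stepB j)) // ler_pM2l.
have B0E : B 0%N = \sum_s `|v 0 s|.
  apply: eq_bigr => s _ /=.
  by have := enum_valP s; rewrite inE => /andP[-> _]; rewrite mulr1.
have B0_gt0 : 0 < B 0%N.
  have /rV0Pn[s nz] := vn0.
  rewrite B0E (bigD1 s) //= ltr_wpDr ?normr_gt0 //.
  by apply: sumr_ge0.
rewrite -(ler_pM2r B0_gt0) (le_trans (powB n)) //.
rewrite B0E mulr_sumr; apply: ler_sum => s _.
by rewrite mulrC ler_wpM2r // ler_nat.
Qed.

Theorem theorem3p9 (R : realType) (k : nat) (f : {poly 'F_2})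
    (hf : ((size f).-1 <= 2 ^ k)%N) :
  lambda R f <= 4 * (1 - 1 / 2 ^+ (k + 2)) `^ (1 / (k + 1)%:R).
Proof.
have x_ge0 : 0 <= 1 - 1 / 2 ^+ (k + 2) :> R.
  by rewrite subr_ge0 ler_pdivrMr ?exprn_gt0 // mul1r exprn_ege1 // ler1n.
set x := 1 - _ in x_ge0 *.
have bound_ge0 : 0 <= 4 * x `^ (1 / (k + 1)%:R) by rewrite mulr_ge0 ?powR_ge0.
rewrite /lambda /perron_root; set E := [set _ | _]%classic.
(* Without positive eigenvalues the supremum takes the default value 0. *)
have [->|/set0P E_neq0] := eqVneq E set0; first by rewrite sup0.
apply: ge_sup => // a [a_gt0 ea].
have hw : (width f <= 2 ^ k)%N by rewrite geq_max expn_gt0 hf.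
have ha : a ^+ k.+1 <= (4 ^ k.+1 - 2 ^ k)%:R.
  apply: (eigenvalue_transition_le a_gt0 ea) => s.
  have := descendants_le0 k.+1 s; have := descendants0_le k.+1 s.
  rewrite (expnS 2); lia.
have {}ha : a ^+ k.+1 <= 4 ^+ k.+1 * x.
  apply: le_trans ha _.
  rewrite natrB; last by rewrite -[4%N]/(2 ^ 2)%N -expnM leq_exp2l //; lia.
  rewrite /x mulrBr mulr1 !natrX lerD2l lerN2.
  rewrite mulrA mulr1 ler_pdivrMr ?exprn_gt0 // -exprD.
  have -> : 4 = 2 ^+ 2 :> R by rewrite -natrX.
  by rewrite -exprM (_ : 2 * k.+1 = k + (k + 2))%N //; lia.
have -> : a = (a ^+ k.+1) `^ (1 / (k + 1)%:R).
  by rewrite -powR_mulrn ?ltW // -powRrM addn1 mul1r mulfV ?pnatr_eq0 // powRr1 // ltW.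
have -> : 4 = (4 ^+ k.+1) `^ (1 / (k + 1)%:R) :> R.
  by rewrite -powR_mulrn // -powRrM addn1 mul1r mulfV ?pnatr_eq0 // powRr1.
rewrite -powRM ?exprn_ge0 //.
by apply: ge0_ler_powR; rewrite ?nnegrE ?divr_ge0 ?mulr_ge0 ?exprn_ge0 // ltW.
Qed.
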